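(* There exists a finitely presented multihomogeneous monoid $N=\langle X\mid\mathcal{S}\rangle$ in which the $o$-conjugacy problem is undecidable. That is, there is no algorithm that takes as input two words over $X$ and decides whether the elements of $N$ they represent are $o$-conjugate in $N$.
   Context: A monoid presentation $\langle X\mid\mathcal{S}\rangle$ (with $\mathcal{S}\subseteq X^*\times X^*$) presents the monoid $X^*/\equiv$, where $\equiv$ is the congruence generated by $\mathcal{S}$. For $u\in X^*$ and $a\in X$, $|u|_a$ denotes the number of occurrences of $a$ in $u$. The presentation is multihomogeneous if for every $(u,v)\in\mathcal{S}$ we have $|u|_a=|v|_a$ for all $a\in X$. A monoid is multihomogeneous if it can be defined by a multihomogeneous presentation. In the statement, $\langle X\mid\mathcal{S}\rangle$ is a multihomogeneous presentation with $X$ and $\mathcal{S}$ finite. For a monoid $N$ and $x,y\in N$, $x\sim_o y$ ($x$ and $y$ are $o$-conjugate) iff there exist $g,h\in N$ with $xg=gy$ and $hx=yh$. *)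

(* Defs.v *)
From HB Require Import structures.
From mathcomp Require Import all_boot.
From mathcomp Require Import boolp.

Set Implicit Arguments.
Unset Strict Implicit.
Unset Printing Implicit Defensive.

Local Open Scope group_scope.
Local Open Scope quotient_scope.

Definition oconj (N : monoidType) (x y : N) : Prop :=
  exists g h : N, x * g = g * y /\ h * x = y * h.

Section Presentation.
Variables (X : finType) (S : seq (seq X * seq X)).

Definition multihomogeneous : Prop :=
  forall uv, uv \in S -> forall a : X, count_mem a uv.1 = count_mem a uv.2.

Inductive cong : seq X -> seq X -> Prop :=
| cong_rel u v : (u, v) \in S -> cong u v
| cong_refl u : cong u u
| cong_sym u v : cong u v -> cong v u
| cong_trans v u w : cong u v -> cong v w -> cong u w
| cong_cat u u' v v' : cong u u' -> cong v v' -> cong (u ++ v) (u' ++ v').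

(* Quotient types are taken modulo boolean relations, hence the classical
   reflection [`[< _ >]] of [cong] into [bool]. *)
Definition congb (u v : seq X) : bool := `[< cong u v >].

Lemma congb_refl : reflexive congb.
Proof. by move=> u; apply/asboolP; exact: cong_refl. Qed.

Lemma congb_sym : symmetric congb.
Proof.
by move=> u v; apply/asboolP/asboolP => ?; apply: cong_sym.
Qed.

Lemma congb_trans : transitive congb.
Proof.
move=> v u w /asboolP uv /asboolP vw; apply/asboolP.
exact: cong_trans uv vw.
Qed.

Canonical congb_equiv := EquivRel congb congb_refl congb_sym congb_trans.

Definition pres_monoid := {eq_quot congb}.

HB.instance Definition _ := Choice.on pres_monoid.

Definition pres_one : pres_monoid := \pi_pres_monoid [::].

Definition pres_mul (x y : pres_monoid) : pres_monoid :=
  \pi_pres_monoid (repr x ++ repr y).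

Lemma pres_eqP (u v : seq X) :
  \pi_pres_monoid u = \pi_pres_monoid v <-> cong u v.
Proof. by split=> [/eqquotP/asboolP|uv] //; apply/eqquotP/asboolP. Qed.

Lemma cong_repr (u : seq X) : cong (repr (\pi_pres_monoid u)) u.
Proof. by apply/pres_eqP; rewrite reprK. Qed.

Lemma pres_mulE (u v : seq X) :
  pres_mul (\pi_pres_monoid u) (\pi_pres_monoid v) = \pi_pres_monoid (u ++ v).
Proof. by apply/pres_eqP; apply: cong_cat; exact: cong_repr. Qed.

Lemma pi_surj (x : pres_monoid) : exists u, x = \pi_pres_monoid u.
Proof. by exists (repr x); rewrite reprK. Qed.

Lemma pres_mulA : associative pres_mul.
Proof.
move=> x y z; have [u ->] := pi_surj x; have [v ->] := pi_surj y.
by have [w ->] := pi_surj z; rewrite !pres_mulE catA.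
Qed.

Lemma pres_mul1g : left_id pres_one pres_mul.
Proof. by move=> x; have [u ->] := pi_surj x; rewrite pres_mulE. Qed.

Lemma pres_mulg1 : right_id pres_one pres_mul.
Proof. by move=> x; have [u ->] := pi_surj x; rewrite pres_mulE cats0. Qed.

HB.instance Definition _ :=
  isMonoid.Build pres_monoid pres_mulA pres_mul1g pres_mulg1.

Definition word_class (u : seq X) : pres_monoid := \pi_pres_monoid u.

End Presentation.

(* Algorithms are deterministic Turing machines with one two-way infinite tape,
   over an input alphabet [I] and a finite work alphabet [work]. *)
Inductive move := Left | Right | Stay.

Record tm (I : finType) := TM {
  state : finType;
  work : finType;
  start : state;
  accepting : pred state;
  trans : state -> option (I + work) -> option (state * option (I + work) * move)
}.

Section Run.
Variables (I : finType) (M : tm I).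

(* [None] is the blank symbol. *)
Definition symbol : Type := option (I + work M).

(* [cells_left] lists the cells strictly left of the head, nearest first;
   [cells_right] lists the scanned cell and those to its right; all cells
   beyond the ends of the lists are blank. *)
Record config := Config {
  cstate : state M;
  cells_left : seq symbol;
  cells_right : seq symbol
}.

Definition move_head (q : state M) (l : seq symbol) (a : symbol)
    (r : seq symbol) (m : move) : config :=
  match m with
  | Left => Config q (behead l) [:: head None l, a & r]
  | Right => Config q (a :: l) r
  | Stay => Config q l (a :: r)
  end.

(* [None] when the machine has halted. *)
Definition step (c : config) : option config :=
  if trans (cstate c) (head None (cells_right c)) is Some (q, a, m)
  then Some (move_head q (cells_left c) a (behead (cells_right c)) m)
  else None.

Definition init (w : seq I) : config :=
  Config (start M) [::] [seq Some (inl i) | i <- w].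

Definition halts_at (w : seq I) (c : config) : Prop :=
  (exists n, iter n (obind step) (Some (init w)) = Some c) /\ step c = None.

End Run.

(* The pair [(u, v)] is written on the tape as [u], a separator, then [v]. *)
Definition pair_input (X : finType) (u v : seq X) : seq (option X) :=
  map Some u ++ None :: map Some v.

Definition tm_decides (X : finType) (M : tm (option X))
    (P : seq X -> seq X -> Prop) : Prop :=
  forall u v, exists2 c : config M,
    halts_at (pair_input u v) c & (accepting (cstate c) <-> P u v).

Definition tm_decidable (X : finType) (P : seq X -> seq X -> Prop) : Prop :=
  exists M : tm (option X), tm_decides M P.

(* Main.v *)
(* A fixed register machine U is coded into a monoid with one central padding
   letter P: a register k of value n is a word Z_k T_k^n (words of distinct
   registers commute), a control state is a word H E^i F, and an instruction
   rewrites around H. Padding makes these rules length preserving, and coding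
   each letter by a block with a fixed content then makes them
   multihomogeneous. Let L be an uncoded letter that commutes with P only. If
   the words u, v of the start and halting configurations become equal after
   padding, then LuL and LvL are o-conjugate through a power of P. Conversely,
   the number of segments between consecutive L's that describe a halting
   configuration is invariant, and comparing it on both sides of
   (LuL) g = g (LvL) shows that U halts from u.
   U is universal: its two input registers hold a table of a Turing machine M
   and the base in which the table is written. U first writes the pair of words
   (LuL, LvL) of its own input as the tape of M, then simulates M, and halts iff
   M rejects. So M does not decide o-conjugacy. *)
From HB Require Import structures.
Require Import Defs.
From mathcomp Require Import all_boot.
From mathcomp Require Import boolp.
From mathcomp Require Import zify.

Set Implicit Arguments.
Unset Strict Implicit.
Unset Printing Implicit Defensive.

(** * Register programs *)

Definition upd (T : eqType) (A : Type) (f : T -> A) (k : T) (v : A) : T -> A :=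
  fun j => if j == k then v else f j.

Lemma upd_same (T : eqType) A (f : T -> A) k v : upd f k v k = v.
Proof. by rewrite /upd eqxx. Qed.

Lemma upd_other (T : eqType) A (f : T -> A) k v j : j != k -> upd f k v j = f j.
Proof. by rewrite /upd => /negbTE ->. Qed.

Lemma upd_upd (T : eqType) A (f : T -> A) k v v' : upd (upd f k v) k v' = upd f k v'.
Proof. by apply/funext => j; rewrite /upd; case: eqP. Qed.

Lemma upd_comm (T : eqType) A (f : T -> A) k k' v v' :
  k != k' -> upd (upd f k v) k' v' = upd (upd f k' v') k v.
Proof.
move=> nk; apply/funext => j; rewrite /upd.
by case: (j =P k') => // ->; rewrite eq_sym (negbTE nk).
Qed.

Lemma upd_id (T : eqType) A (f : T -> A) k : upd f k (f k) = f.
Proof. by apply/funext => j; rewrite /upd; case: eqP => // ->. Qed.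

Lemma iter_None (T : Type) (f : T -> option T) n : iter n (obind f) None = None.
Proof. by elim: n => //= n ->. Qed.

Inductive prog (R : Type) :=
  | Inc of R
  | Dec of R
  | Seq of prog R & prog R
  | While of R & prog R
  | IfZ of R & prog R.

(** Classical equality is enough: it only serves to list and number the points of a fixed
    program. *)
HB.instance Definition _ (R : Type) := gen_eqMixin (prog R).

Section Programs.
Variables (R : eqType) (k0 : R).
Implicit Types (p q : prog R) (K : seq (prog R)) (s : R -> nat).

(* [Some (k, (a, Kz), (b, Kt))]: if register [k] is [0], set it to [a] and
   continue with [Kz]; if it is [n + 1], set it to [n + b] and continue with
   [Kt]. The register is irrelevant for [Seq]. *)
Definition branch K : option (R * (nat * seq (prog R)) * (nat * seq (prog R))) :=
  match K with
  | [::] => None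
  | Inc k :: K' => Some (k, (1, K'), (2, K'))
  | Dec k :: K' => Some (k, (0, K'), (0, K'))
  | Seq p q :: K' => Some (k0, (0, [:: p, q & K']), (1, [:: p, q & K']))
  | While k p :: K' => Some (k, (0, K'), (1, p :: K))
  | IfZ k p :: K' => Some (k, (0, p :: K'), (1, K'))
  end.

Definition pstep (c : seq (prog R) * (R -> nat)) :=
  if branch c.1 is Some (k, (a, Kz), (b, Kt)) then
    Some (if c.2 k is n.+1 then (Kt, upd c.2 k (n + b)) else (Kz, upd c.2 k a))
  else None.

Definition reaches c c' := exists n, iter n (obind pstep) (Some c) = Some c'.

Definition terminates c := exists s, reaches c ([::], s).

Lemma reach_refl c : reaches c c. Proof. by exists 0. Qed.

Lemma reach_trans c1 c2 c3 : reaches c1 c2 -> reaches c2 c3 -> reaches c1 c3.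
Proof. by move=> [m hm] [n hn]; exists (n + m); rewrite iterD hm. Qed.

Lemma reach_step c c' : pstep c = Some c' -> reaches c c'.
Proof. by move=> h; exists 1. Qed.

Lemma terminates_step c c' :
  pstep c = Some c' -> terminates c <-> terminates c'.
Proof.
move=> cc'; split=> [[s [[|n] h]]|[s h]].
- by case: h cc' => ->.
- by exists s, n; move: h; rewrite iterSr /= cc'.
- by exists s; apply: reach_trans h; exact: reach_step.
Qed.

Lemma terminates_reach c c' : reaches c c' -> terminates c <-> terminates c'.
Proof.
move=> [n]; elim: n c => [|n IH] c; first by case=> ->.
rewrite iterSr /=; case E: (pstep c) => [c1|]; last by rewrite iter_None.
by move/IH => h; rewrite (terminates_step E).
Qed.

(** Steps are deterministic, so a configuration on a cycle recurs forever, whereas every iterate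
    after a halt is [None]. *)
Lemma cycle_not_terminates c c1 : pstep c = Some c1 -> reaches c1 c -> ~ terminates c.
Proof.
move=> cc1 [m hm] [s [n hn]].
have cyc : iter m.+1 (obind pstep) (Some c) = Some c by rewrite iterSr /= cc1.
have cycs j : iter (j * m.+1) (obind pstep) (Some c) = Some c.
  by elim: j => // j IH; rewrite mulSn iterD IH.
(* The multiple [n.+1 * m.+1] of the period exceeds the supposed halting time [n]. *)
have : iter (n.+1 * m.+1 - n) (obind pstep) (iter n (obind pstep) (Some c)) = Some c.
  by rewrite -iterD subnK ?cycs //; lia.
by rewrite hn; case E: (_ - _) => [|j]; [lia|rewrite iterSr iter_None].
Qed.

Definition executes p s s' := forall K, reaches (p :: K, s) (K, s').

Lemma exec_inc k s : executes (Inc k) s (upd s k (s k).+1).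
Proof. by move=> K; apply: reach_step; rewrite /pstep /=; case: (s k) => // n; rewrite addn2. Qed.

Lemma exec_dec k s : executes (Dec k) s (upd s k (s k).-1).
Proof. by move=> K; apply: reach_step; rewrite /pstep /=; case: (s k) => // n; rewrite addn0. Qed.

Lemma upd_test k s n : s k = n.+1 -> upd s k (n + 1) = s.
Proof. by rewrite addn1 => <-; rewrite upd_id. Qed.

Lemma upd_test0 k s : s k = 0 -> upd s k 0 = s.
Proof. by move=> <-; rewrite upd_id. Qed.

Lemma reach_seq p q K s : reaches (Seq p q :: K, s) ([:: p, q & K], s).
Proof.
apply: reach_step; rewrite /pstep /=; case E: (s k0) => [|n].
- by rewrite upd_test0.
- by rewrite upd_test.
Qed.

Lemma exec_seq p q s1 s2 s3 : executes p s1 s2 -> executes q s2 s3 -> executes (Seq p q) s1 s3.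
Proof.
move=> h1 h2 K; apply: reach_trans (h2 K); apply: reach_trans (h1 _).
exact: reach_seq.
Qed.

Lemma pstep_while k p K s :
  s k != 0 -> pstep (While k p :: K, s) = Some ([:: p, While k p & K], s).
Proof. by rewrite /pstep /=; case E: (s k) => [|n] // _; rewrite upd_test. Qed.

Lemma exec_while0 k p s : s k = 0 -> executes (While k p) s s.
Proof. by move=> E K; apply: reach_step; rewrite /pstep /= E upd_test0. Qed.

Lemma exec_whileS k p s1 s2 s3 :
  s1 k != 0 -> executes p s1 s2 -> executes (While k p) s2 s3 -> executes (While k p) s1 s3.
Proof.
move=> E h1 h2 K; apply: reach_trans (h2 K); apply: reach_trans (h1 _).
by apply: reach_step; exact: pstep_while.
Qed.

Lemma exec_ifz0 k p s s' : s k = 0 -> executes p s s' -> executes (IfZ k p) s s'.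
Proof.
move=> E h K; apply: reach_trans (h K).
by apply: reach_step; rewrite /pstep /= E upd_test0.
Qed.

Lemma exec_ifzS k p s : s k != 0 -> executes (IfZ k p) s s.
Proof.
move=> E K; apply: reach_step; rewrite /pstep /=.
by case E': (s k) E => [|n] // _; rewrite upd_test.
Qed.

(** These are the continuations met while [p] runs before [K]. A loop body continues with its own
    loop, so the list is finite and continuations can serve as control states. *)
Fixpoint conts p K : seq (seq (prog R)) :=
  match p with
  | Inc _ | Dec _ => [:: p :: K]
  | Seq p1 p2 => (p :: K) :: conts p1 (p2 :: K) ++ conts p2 K
  | While k p1 => (p :: K) :: conts p1 (p :: K)
  | IfZ k p1 => (p :: K) :: conts p1 K
  end.

Lemma conts_head p K : exists l, conts p K = (p :: K) :: l.
Proof. by case: p => /= *; eexists. Qed.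

Lemma conts_self p K : (p :: K) \in conts p K.
Proof. by have [l ->] := conts_head p K; rewrite inE eqxx. Qed.

Lemma conts_closed p K K' k a Kz b Kt :
  K' \in conts p K -> branch K' = Some (k, (a, Kz), (b, Kt)) ->
  Kz \in K :: conts p K /\ Kt \in K :: conts p K.
Proof.
elim: p K => [i|i|p IHp q IHq|i p IHp|i p IHp] K /=; rewrite ?inE ?mem_cat.
- by move/eqP=> -> [_ _ <- _ <-]; rewrite eqxx.
- by move/eqP=> -> [_ _ <- _ <-]; rewrite eqxx.
- case/or3P=> [/eqP -> [_ _ <- _ <-]|h1 h2|h1 h2].
  + by rewrite conts_self !orbT.
  + case: (IHp _ h1 h2); rewrite !inE => /orP[/eqP->|->] /orP[/eqP->|->];
    by rewrite ?conts_self !orbT.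
  + case: (IHq _ h1 h2); rewrite !inE => /orP[/eqP->|->] /orP[/eqP->|->];
    by rewrite ?eqxx ?orbT.
- case/orP=> [/eqP -> [_ _ <- _ <-]|h1 h2].
    by rewrite eqxx conts_self !orbT.
  by case: (IHp _ h1 h2); rewrite !inE => /orP[/eqP->|->] /orP[/eqP->|->];
    rewrite ?eqxx ?orbT.
- case/orP=> [/eqP -> [_ _ <- _ <-]|h1 h2].
    by rewrite eqxx conts_self !orbT.
  by case: (IHp _ h1 h2); rewrite !inE => /orP[/eqP->|->] /orP[/eqP->|->];
    rewrite ?eqxx ?orbT.
Qed.

(** The halted point gets index 0 and the start point index 1 for every program, so their state
    words are known without unfolding the program. *)
Definition points p := [::] :: conts p [::].

Lemma points_start p : index [:: p] (points p) = 1.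
Proof. by rewrite /points; have [l ->] := conts_head p [::]; rewrite /= eqxx. Qed.

Lemma start_points p : [:: p] \in points p.
Proof. by rewrite inE conts_self orbT. Qed.

Lemma points_closed p K k a Kz b Kt :
  K \in points p -> branch K = Some (k, (a, Kz), (b, Kt)) ->
  Kz \in points p /\ Kt \in points p.
Proof. by rewrite inE => /orP[/eqP ->//|]; exact: conts_closed. Qed.

End Programs.

(** * The multihomogeneous monoid of a program *)

Section MonoidOfProgram.
Variables (R : finType) (k0 : R) (U : prog R).
Implicit Types (k : R) (K : seq (prog R)) (s : R -> nat).

(* [inl] letters are the padding symbol and the three letters from which
   states [H E^i F] are built; [Z k T k^n] records the value [n] of register
   [k]. *)
Definition letter : finType := (bool * bool + R * bool)%type.
Definition lP : letter := inl (false, false).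
Definition lH : letter := inl (true, false).
Definition lE : letter := inl (true, true).
Definition lF : letter := inl (false, true).
Definition lT k : letter := inr (k, true).
Definition lZ k : letter := inr (k, false).
Implicit Types (u v w : seq letter) (l : letter).

Definition gen : finType := (bool * bool)%type.
Definition gA : gen := (false, false).
Definition gB : gen := (true, false).
Definition gD : gen := (false, true).
Definition gL : gen := (true, true).
Implicit Types (x y g : seq gen).

(* All letters receive codes with the same content, which makes length
   preserving relations multihomogeneous. *)
Definition block l : seq gen :=
  gB :: nseq (enum_rank l) gA ++ gD :: nseq (#|letter| - enum_rank l) gA.
Definition code w := flatten (map block w).

Definition idx K := index K (points U).
Definition state_word K := lH :: nseq (idx K) lE ++ [:: lF].

Definition pad (r : seq letter * seq letter) :=
  (r.1 ++ nseq (size r.2 - size r.1) lP, r.2 ++ nseq (size r.1 - size r.2) lP).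

(** The letter to the left of the state word performs the zero test: with the track of [k] moved
    there, it is [lZ k] if the register is empty and [lT k] otherwise. *)
Definition point_rules K :=
  if branch k0 K is Some (k, (a, Kz), (b, Kt)) then
    [:: (lZ k :: state_word K, lZ k :: nseq a (lT k) ++ state_word Kz);
        (lT k :: state_word K, nseq b (lT k) ++ state_word Kt)]
  else [::].

Definition letter_rules : seq (seq letter * seq letter) :=
  [seq ([:: lP; l], [:: l; lP]) | l <- enum letter] ++
  [seq ([:: inr t.1; inr t.2], [:: inr t.2; inr t.1]) |
    t <- [seq t <- enum {: (R * bool) * (R * bool)} | t.1.1 != t.2.1]] ++
  [seq pad r | r <- flatten (map point_rules (points U))].

Definition rules : seq (seq gen * seq gen) :=
  (block lP ++ [:: gL], gL :: block lP) ::
  [seq (code r.1, code r.2) | r <- letter_rules].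

Lemma letter_rules_size r : r \in letter_rules -> size r.1 = size r.2.
Proof.
rewrite !mem_cat => /or3P[] /mapP[t _ ->] //=.
by rewrite !size_cat !size_nseq; lia.
Qed.

Lemma count_block (a : gen) l :
  count_mem a (block l) = (gB == a) + (gD == a) + (gA == a) * #|letter|.
Proof.
rewrite /block [in LHS]/= count_cat /= !count_nseq /=.
have /ltnW h := ltn_ord (enum_rank l).
rewrite -[in RHS](subnKC h) mulnDr; move: (_ * _) (_ * _) => p q. lia.
Qed.

Lemma count_code (a : gen) w :
  count_mem a (code w) = size w * count_mem a (block lP).
Proof.
elim: w => // l w IH.
have -> : code (l :: w) = block l ++ code w by [].
by rewrite count_cat IH [size (_ :: _)]/= mulSn !count_block.
Qed.

Lemma multihomogeneous_rules : multihomogeneous rules.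
Proof.
move=> uv; rewrite inE => /orP[/eqP -> a|/mapP[r rin -> a]].
  have E : count_mem a (block lP ++ [:: gL]) = count_mem a ([:: gL] ++ block lP).
    by rewrite !count_cat addnC.
  exact: E.
by rewrite !count_code (letter_rules_size rin).
Qed.

Lemma cong_count x y : cong rules x y ->
  forall a : gen, count_mem a x = count_mem a y.
Proof.
elim=> {x y} [u v uv a|//|u v _ h a|u v w _ h1 _ h2 a|u u' v v' _ h1 _ h2 a].
- exact: (multihomogeneous_rules uv).
- by rewrite h.
- by rewrite h1.
- by rewrite !count_cat h1 h2.
Qed.

(** * From halting runs to o-conjugacy *)

Lemma code_cat u v : code (u ++ v) = code u ++ code v.
Proof. by rewrite /code map_cat flatten_cat. Qed.

Definition eqw u v := cong rules (code u) (code v).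
Notation pads n := (nseq n lP).

Lemma eqw_refl u : eqw u u. Proof. exact: cong_refl. Qed.
Lemma eqw_sym u v : eqw u v -> eqw v u. Proof. exact: cong_sym. Qed.
Lemma eqw_trans v u w : eqw u v -> eqw v w -> eqw u w. Proof. exact: cong_trans. Qed.
Lemma eqw_cat u u' v v' : eqw u u' -> eqw v v' -> eqw (u ++ v) (u' ++ v').
Proof. by rewrite /eqw !code_cat; exact: cong_cat. Qed.

Lemma eqw_rule r : r \in letter_rules -> eqw r.1 r.2.
Proof.
by move=> rin; apply: cong_rel; rewrite inE; apply/orP; right; apply/mapP; exists r.
Qed.

Lemma eqw_comm u v :
  (forall a b, a \in u -> b \in v -> eqw [:: a; b] [:: b; a]) ->
  eqw (u ++ v) (v ++ u).
Proof.
move=> h; have h1 a : a \in u -> eqw (a :: v) (v ++ [:: a]).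
  move=> au; elim: v h => [|b v IH] h; first exact: eqw_refl.
  apply: (@eqw_trans ([:: b; a] ++ v)).
    by apply: (@eqw_cat [:: a; b] [:: b; a] v v); [apply: h; rewrite ?inE ?eqxx|exact: eqw_refl].
  apply: (@eqw_cat [:: b] [:: b] (a :: v) (v ++ [:: a])); first exact: eqw_refl.
  by apply: IH => ? ? ? ?; apply: h => //; rewrite inE; apply/orP; right.
elim: u {h} h1 => [|a u IH] h; first by rewrite cats0; exact: eqw_refl.
apply: (@eqw_trans ([:: a] ++ (v ++ u))).
  apply: (@eqw_cat [:: a] [:: a]); first exact: eqw_refl.
  by apply: IH => b bu; apply: h; rewrite inE bu orbT.
rewrite -[v ++ a :: u]cat_rcons catA -cats1.
by apply: eqw_cat; [apply: h; rewrite inE eqxx|exact: eqw_refl].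
Qed.

Lemma pads_comm n u : eqw (pads n ++ u) (u ++ pads n).
Proof.
apply: eqw_comm => a b /nseqP[-> _] _.
apply: (@eqw_rule ([:: lP; b], [:: b; lP])).
by rewrite mem_cat; apply/orP; left; apply/mapP; exists b => //; rewrite mem_enum.
Qed.

Lemma track_comm (t t' : R * bool) : t.1 != t'.1 ->
  eqw [:: inr t; inr t'] [:: inr t'; inr t].
Proof.
move=> tt'; apply: (@eqw_rule ([:: inr t; inr t'], [:: inr t'; inr t])).
rewrite !mem_cat; apply/or3P; apply: Or32; apply/mapP.
by exists (t, t') => //; rewrite mem_filter tt' mem_enum.
Qed.

(** An instruction may change the length of a configuration, while the rules preserve length;
    padding on both sides absorbs the difference. *)
Definition padeq u v := exists m n, eqw (u ++ pads m) (v ++ pads n).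

Lemma padeq_refl u : padeq u u.
Proof. by exists 0, 0; exact: eqw_refl. Qed.

Lemma padeq_eqw u v : eqw u v -> padeq u v.
Proof. by exists 0, 0; rewrite !cats0. Qed.

Lemma padeq_trans v u w : padeq u v -> padeq v w -> padeq u w.
Proof.
move=> [m [n h]] [m' [n' h']]; exists (m + m'), (n' + n).
rewrite !nseqD !catA; apply: (@eqw_trans ((v ++ pads n) ++ pads m')).
  by apply: eqw_cat => //; exact: eqw_refl.
rewrite -catA -nseqD addnC nseqD catA.
by apply: eqw_cat => //; exact: eqw_refl.
Qed.

Lemma padeq_catl w u v : padeq u v -> padeq (w ++ u) (w ++ v).
Proof.
by move=> [m [n h]]; exists m, n; rewrite -!catA; apply: eqw_cat => //; exact: eqw_refl.
Qed.

Definition track s k := lZ k :: nseq (s k) (lT k).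
Definition regs_word s := flatten [seq track s k | k <- enum R].
Definition config_word K s := regs_word s ++ state_word K.

Lemma track_letter s k l : l \in track s k -> exists b, l = inr (k, b).
Proof. by rewrite inE => /orP[/eqP ->|/nseqP[-> _]]; eexists. Qed.

(** Tracks of distinct registers commute. The list [ks] is chosen before [s], so that one order of
    the other registers serves both before and after a step. *)
Lemma regs_word_bring k : exists2 ks : seq R, k \notin ks &
  forall s, eqw (regs_word s) (flatten [seq track s j | j <- ks] ++ track s k).
Proof.
have kin : k \in enum R by rewrite mem_enum.
move: (enum_uniq R); rewrite /regs_word; case/splitPr: (enum R) / kin => k1 k2 uk.
have nk : k \notin k1 ++ k2.
  by move: uk; rewrite uniq_catC /= mem_cat orbC -mem_cat => /andP[].
exists (k1 ++ k2) => // s; rewrite !map_cat !flatten_cat map_cons.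
rewrite -[flatten (_ :: _)]/(_ ++ _) -catA; apply: eqw_cat; first exact: eqw_refl.
apply: eqw_comm => a b /track_letter[c ->] /flattenP[_ /mapP[j jk2 ->]].
move=> /track_letter[d ->]; apply: track_comm => /=.
by apply: contraNneq nk => ->; rewrite mem_cat jk2 orbT.
Qed.

Lemma padeq_rule K r : K \in points U -> r \in point_rules K -> padeq r.1 r.2.
Proof.
move=> Kin rin; exists (size r.2 - size r.1), (size r.1 - size r.2).
apply: (@eqw_rule (pad r)); rewrite !mem_cat; apply/or3P; apply: Or33.
by apply/mapP; exists r => //; apply/flattenP; exists (point_rules K); rewrite ?map_f.
Qed.

Lemma padeq_step K s K' s' : K \in points U ->
  pstep k0 (K, s) = Some (K', s') ->
  K' \in points U /\ padeq (config_word K s) (config_word K' s').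
Proof.
move=> Kin; rewrite /pstep /=.
case EB: (branch k0 K) => [[[k [a Kz]] [b Kt]]|] // [].
have [Kzin Ktin] := points_closed Kin EB.
have [ks nk bring] := regs_word_bring k.
have ksE n : flatten [seq track (upd s k n) j | j <- ks] = flatten [seq track s j | j <- ks].
  congr flatten; apply/eq_in_map => j jks; rewrite /track upd_other //.
  by apply: contraNneq nk => <-.
have canon J t : padeq (config_word J t)
    (flatten [seq track t j | j <- ks] ++ track t k ++ state_word J).
  by apply: padeq_eqw; rewrite catA; apply: eqw_cat => //; exact: eqw_refl.
have canon' J t : padeq (flatten [seq track t j | j <- ks] ++ track t k ++ state_word J)
    (config_word J t).
  apply: padeq_eqw; rewrite catA; apply: eqw_cat; last exact: eqw_refl.
  exact: eqw_sym.
case Esk: (s k) => [|n] [<- <-]; split => //; apply: padeq_trans (canon _ _) _;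
  apply: padeq_trans (canon' _ _); rewrite ksE; apply: padeq_catl.
- rewrite /track Esk upd_same.
  apply: (@padeq_rule K (lZ k :: state_word K, lZ k :: nseq a (lT k) ++ state_word Kz)) => //.
  by rewrite /point_rules EB inE eqxx.
(* One [lT k] is split off next to the state word, for the rule to consume. *)
- rewrite /track upd_same Esk -addn1 !nseqD -!cat_cons -!catA.
  apply: padeq_catl.
  apply: (@padeq_rule K (lT k :: state_word K, nseq b (lT k) ++ state_word Kt)) => //.
  by rewrite /point_rules EB !inE eqxx orbT.
Qed.

Lemma padeq_reach K s K' s' : K \in points U ->
  reaches k0 (K, s) (K', s') -> padeq (config_word K s) (config_word K' s').
Proof.
move=> Kin [n]; elim: n K s Kin => [|n IH] K s Kin.
  by case=> -> ->; exact: padeq_refl.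
rewrite iterSr; case E: (obind _ _) => [[K1 s1]|]; last by rewrite iter_None.
have [K1in h] := padeq_step Kin E.
by move/(IH _ _ K1in); exact: padeq_trans.
Qed.

(** The rules let padding pass [gL] and whole codes of letters; [z] is therefore required to be a
    product of these. *)
Lemma pads_gen_comm n (z : seq gen) :
  (exists ws : seq (seq letter), z = flatten [seq gL :: code w | w <- ws]) ->
  cong rules (code (pads n) ++ z) (z ++ code (pads n)).
Proof.
case=> ws ->; elim: ws => [|w ws IH]; first by rewrite cats0; exact: cong_refl.
have padL : cong rules (code (pads n) ++ [:: gL]) (gL :: code (pads n)).
  elim: n {IH} => [|n IH]; first exact: cong_refl.
  rewrite -addn1 nseqD code_cat -catA [code [:: lP]]/(code _) /= cats0.
  apply: (cong_trans (v := code (pads n) ++ (gL :: block lP))).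
    apply: cong_cat; first exact: cong_refl.
    by apply: cong_rel; rewrite inE eqxx.
  rewrite -cat_rcons -cats1 -cat_cons; apply: cong_cat => //; exact: cong_refl.
rewrite map_cons -[flatten (_ :: _)]/([:: gL] ++ (code w ++ flatten _)).
set c := code (pads n) in IH padL *; set z' := flatten _ in IH *.
apply: (cong_trans (v := ([:: gL] ++ c) ++ (code w ++ z'))).
  by rewrite catA; apply: cong_cat => //; exact: cong_refl.
apply: (cong_trans (v := [:: gL] ++ ((code w ++ c) ++ z'))).
  rewrite -catA (catA c); apply: cong_cat; first exact: cong_refl.
  apply: cong_cat; last exact: cong_refl.
  by rewrite -!code_cat; exact: pads_comm.
rewrite -!catA; apply: cong_cat; first exact: cong_refl.
by apply: cong_cat; first exact: cong_refl.
Qed.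

Definition start_letters s := config_word [:: U] s.
(** The relation [xg = gy] forces [x] and [y] to have the same content in a multihomogeneous monoid,
    hence the padding up to the length of the start word. *)
Definition final_letters s :=
  config_word [::] (fun=> 0) ++ pads (size (start_letters s) - size (config_word [::] (fun=> 0))).
Definition start_word s := gL :: code (start_letters s) ++ [:: gL].
Definition final_word s := gL :: code (final_letters s) ++ [:: gL].

Lemma size_config K s : size (config_word K s) = \sum_k s k + (#|R| + idx K + 2).
Proof.
rewrite size_cat /= size_cat /= size_nseq size_flatten /shape -map_comp.
rewrite sumnE big_map big_enum /= (eq_bigr (fun k => s k + 1)); last first.
  by move=> k _ /=; rewrite size_nseq addn1.
rewrite big_split /= sum_nat_const muln1.
have -> : \sum_(k in R) s k = \sum_k s k by exact: eq_bigl.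
by rewrite cardT; lia.
Qed.

Lemma idx_nil : idx [::] = 0.
Proof. by []. Qed.

(** The difference consists of the units held by the registers and the one [lE] of the start state.
    In particular the truncated subtraction in [final_letters] is exact. *)
Lemma final_pads s :
  size (start_letters s) - size (config_word [::] (fun=> 0)) = (\sum_k s k).+1.
Proof.
have z : \sum_(k : R) (fun=> 0) k = 0 by rewrite big1.
by rewrite /start_letters !size_config [idx [:: U]]points_start idx_nil z; lia.
Qed.

Lemma word_classM x y :
  (word_class rules x * word_class rules y)%g = word_class rules (x ++ y).
Proof. exact: pres_mulE. Qed.

(** With [c] the code of [m] padding letters, the run gives [xc = yc], and [c] commutes with [x] and
    with [y]; so [c] conjugates in both directions. *)
Lemma oconj_of_reach s : reaches k0 ([:: U], s) ([::], fun=> 0) ->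
  oconj (word_class rules (start_word s)) (word_class rules (final_word s)).
Proof.
move/(padeq_reach (start_points U)) => [m [n h]].
(* Each block contains exactly one [gB], so counting [gB] compares numbers of letters. *)
have sz : size (start_letters s) + m = size (config_word [::] (fun=> 0)) + n.
  have := cong_count h gB; rewrite !count_code count_block !size_cat !size_nseq.
  by rewrite mul0n addn0 !muln1.
have {h sz} h : eqw (start_letters s ++ pads m) (final_letters s ++ pads m).
  apply: (eqw_trans h); rewrite /final_letters -(catA _ (pads _) (pads m)) -nseqD.
  have -> : n = size (start_letters s) - size (config_word [::] (fun=> 0)) + m.
    by have := final_pads s; lia.
  exact: eqw_refl.
have central w : cong rules (code (pads m) ++ (gL :: code w ++ [:: gL]))
                            ((gL :: code w ++ [:: gL]) ++ code (pads m)).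
  by apply: pads_gen_comm; exists [:: w; [::]].
have inner w : cong rules ((gL :: code w ++ [:: gL]) ++ code (pads m))
                          (gL :: code (w ++ pads m) ++ [:: gL]).
  apply: (cong_trans (cong_sym (central w))).
  apply: (cong_trans (v := (gL :: code (pads m)) ++ code w ++ [:: gL])).
    rewrite -[gL :: code w ++ _]cat1s catA -[gL :: code (pads m)]cats0.
    apply: cong_cat; last exact: cong_refl.
    rewrite cats0; have := @pads_gen_comm m [:: gL]; apply.
    by exists [:: [::]].
  rewrite -cat1s -catA -[gL :: code _ ++ _]cat1s; apply: cong_cat; first exact: cong_refl.
  rewrite catA; apply: cong_cat; last exact: cong_refl.
  by rewrite -code_cat; exact: pads_comm.
have main : cong rules (start_word s ++ code (pads m)) (final_word s ++ code (pads m)).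
  apply: (cong_trans (inner _)); apply: cong_sym; apply: (cong_trans (inner _)).
  apply: (@cong_cat _ _ [:: gL] [:: gL]); first exact: cong_refl.
  by apply: cong_cat; [exact: cong_sym|exact: cong_refl].
exists (word_class rules (code (pads m))), (word_class rules (code (pads m))).
rewrite !word_classM; split; apply/pres_eqP.
  by apply: (cong_trans main); exact/cong_sym/central.
by apply: (cong_trans (central _)).
Qed.

(** * An invariant of letter words: parsing a configuration *)

Inductive reading :=
  | ReadingRegs of (R -> option nat)
  | ReadingState of (R -> option nat) & nat
  | Parsed of (R -> option nat) & nat
  | Malformed.
Implicit Types (o : reading) (f : R -> option nat).

(** Padding is skipped in every state. A register is [None] until its [lZ] is read, and its [lT] are
    accepted only afterwards; tracks may be interleaved, because letters of distinct registers
    commute. *)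
Definition act o l :=
  match l, o with
  | inl (false, false), _ => o
  | inr (k, true), ReadingRegs f =>
      if f k is Some n then ReadingRegs (upd f k (Some n.+1)) else Malformed
  | inr (k, false), ReadingRegs f =>
      if f k is None then ReadingRegs (upd f k (Some 0)) else Malformed
  | inl (true, false), ReadingRegs f => ReadingState f 0
  | inl (true, true), ReadingState f i => ReadingState f i.+1
  | inl (false, true), ReadingState f i => Parsed f i
  | _, _ => Malformed
  end.

(** The invariant is used in proofs only, so termination may enter as a classical truth value. *)
Definition halting o :=
  if o is Parsed f i then
    `[< exists K s, [/\ K \in points U, idx K = i, f = Some \o s &
                        terminates k0 (K, s)] >]
  else false.

Definition final o := if o is Parsed _ _ then true else if o is Malformed then true else false.

(** An instruction rule changes the parsed configuration but not whether it halts, so final states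
    are compared by [halting] alone. This is stable under [act]: padding changes nothing and any
    other letter makes both final states [Malformed]. *)
Definition oeq o o' := o = o' \/ [/\ final o, final o' & halting o = halting o'].

Lemma oeq_halting o o' : oeq o o' -> halting o = halting o'.
Proof. by case=> [->|[]]. Qed.

Lemma oeq_trans o2 o1 o3 : oeq o1 o2 -> oeq o2 o3 -> oeq o1 o3.
Proof.
case=> [->//|[t1 t2 h]] [<-|[_ t3 h']]; first by right.
by right; rewrite h h'.
Qed.

Lemma oeq_act l o o' : oeq o o' -> oeq (act o l) (act o' l).
Proof.
case=> [->|]; first by left.
case: l => [[[] []]|[k []]]; case: o => [f|f i|f i|] [] // _; case: o' => [f'|f' i'|f' i'|] // _ h;
  by [left|right].
Qed.

Definition acts o w := foldl act o w.

Lemma acts_cat o u v : acts o (u ++ v) = acts (acts o u) v.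
Proof. exact: foldl_cat. Qed.

Lemma acts_Fail w : acts Malformed w = Malformed.
Proof. by elim: w => //= l w IH; rewrite -[RHS]IH; case: l => [[[] []]|[k []]]. Qed.

Lemma acts_pads o n : acts o (pads n) = o.
Proof. by elim: n. Qed.

Lemma acts_state_word f K : acts (ReadingRegs f) (state_word K) = Parsed f (idx K).
Proof.
rewrite /= /acts foldl_cat /=.
suff -> i n : foldl act (ReadingState f i) (nseq n lE) = ReadingState f (i + n) by [].
by elim: n i => [|n IH] i /=; rewrite ?addn0 // IH addSnnS.
Qed.

Lemma acts_not_regs o K : (forall f, o <> ReadingRegs f) -> acts o (state_word K) = Malformed.
Proof. by case: o => [f /(_ f)//|f i _|f i _|_]; exact: acts_Fail. Qed.

Lemma acts_lT f k n b :
  f k = Some n -> acts (ReadingRegs f) (nseq b (lT k)) = ReadingRegs (upd f k (Some (n + b))).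
Proof.
elim: b f n => [|b IH] f n fk /=; first by rewrite addn0 -fk upd_id.
by rewrite fk (IH _ n.+1) ?upd_same // upd_upd addSnnS.
Qed.

Lemma halting_config K s : K \in points U ->
  halting (Parsed (Some \o s) (idx K)) = `[< terminates k0 (K, s) >].
Proof.
move=> Kin /=; apply/asbool_equiv_eq; split=> [[K' [s' [K'in E Es h]]]|h].
  have -> : K = K' by rewrite -(nth_index [::] Kin) -(nth_index [::] K'in) -/(idx K) -/(idx K') E.
  suff -> : s = s' by [].
  by apply/funext => k; move/(congr1 (@^~ k)): Es => [].
by exists K, s.
Qed.

Lemma halting_partial f k i : f k = None -> halting (Parsed f i) = false.
Proof.
by move=> fk; apply/negbTE/asboolPn => -[K [s [_ _ E _]]]; rewrite E in fk.
Qed.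

(* Registers other than the tested one may be unread; then neither side halts. *)
Lemma halting_branch f k n m K K' : K \in points U -> K' \in points U ->
  (forall s, s k = n -> pstep k0 (K, s) = Some (K', upd s k m)) ->
  halting (Parsed (upd f k (Some n)) (idx K)) =
  halting (Parsed (upd f k (Some m)) (idx K')).
Proof.
move=> Kin K'in step.
case: (pselect (exists j, j != k /\ f j = None)) => [[j [jk fj]]|full].
  by rewrite !(@halting_partial _ j) // upd_other.
pose s j := odflt 0 (f j).
have fE (i : nat) : upd f k (Some i) = Some \o upd s k i.
  apply/funext => j; rewrite /= /upd /s; case: eqP => // /eqP jk.
  case E: (f j) => //; by case: full; exists j.
rewrite !fE !halting_config //; apply/asbool_equiv_eq.
by apply: terminates_step; rewrite step ?upd_same // upd_upd.
Qed.

Lemma point_rule_oeq K r o : K \in points U -> r \in point_rules K ->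
  oeq (acts o r.1) (acts o r.2).
Proof.
move=> Kin; rewrite /point_rules.
case EB: (branch k0 K) => [[[k [a Kz]] [b Kt]]|] //.
move=> rin; have [Kzin Ktin] := points_closed Kin EB.
case: (pselect (exists f, o = ReadingRegs f)) => [[f ->]|no]; last first.
  left; have no' f : o <> ReadingRegs f by move=> E; apply: no; exists f.
  (* Outside the register phase, register letters and [lH] all lead to [Malformed], and each side of
     the rule contains [lH]. *)
  have fail u J : (forall l, l \in u -> exists t, l = inr t) ->
      acts o (u ++ state_word J) = Malformed.
    case: u => [|l u] h; first exact: acts_not_regs.
    have [t ->] := h l (mem_head _ _); rewrite /= -[RHS](acts_Fail (u ++ state_word J)).
    by case: t => j []; case: o no' {no} => // g /(_ g).
  rewrite !inE in rin; case/orP: rin => /eqP ->.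
    rewrite -cat1s -cat_cons !fail // => l; rewrite inE.
      by case/orP => [/eqP ->|/nseqP[-> _]]; eexists.
    by move/eqP ->; eexists.
  rewrite -cat1s !fail // => l; first by case/nseqP => -> _; eexists.
  by rewrite inE => /eqP ->; eexists.
have oeq_config f1 f2 i j : halting (Parsed f1 i) = halting (Parsed f2 j) ->
  oeq (Parsed f1 i) (Parsed f2 j) by right.
rewrite !inE in rin; case/orP: rin => /eqP ->; rewrite [_.1]/= [_.2]/=.
- change (oeq (acts (act (ReadingRegs f) (lZ k)) (state_word K))
              (acts (act (ReadingRegs f) (lZ k)) (nseq a (lT k) ++ state_word Kz))).
  rewrite [act _ _]/=; case fk: (f k) => [n|]; first by rewrite !acts_Fail; left.
  rewrite acts_cat (@acts_lT _ _ 0) ?upd_same // upd_upd !acts_state_word.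
  apply/oeq_config/halting_branch => // s sk.
  by rewrite /pstep EB /= sk.
- change (oeq (acts (act (ReadingRegs f) (lT k)) (state_word K))
              (acts (ReadingRegs f) (nseq b (lT k) ++ state_word Kt))).
  rewrite [act _ _]/= acts_cat; case fk: (f k) => [n|].
    rewrite (@acts_lT _ _ n) // !acts_state_word.
    apply/oeq_config/halting_branch => // s sk.
    by rewrite /pstep EB /= sk.
  (* Register [k] is unread, so the left side is malformed. For [b = 0] the right side can still be
     parsed, but as a partial configuration, which does not halt. *)
  rewrite acts_Fail; case: b {EB} => [|b].
    by rewrite acts_state_word; right; split=> //; rewrite (@halting_partial _ k).
  by left; rewrite /= fk !acts_Fail.
Qed.

Lemma letter_rule_oeq r o : r \in letter_rules -> oeq (acts o r.1) (acts o r.2).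
Proof.
rewrite !mem_cat => /or3P[/mapP[l _ ->]|/mapP[[[k b] [k' b']]]|/mapP[r0]].
- by left.
- rewrite mem_filter /= => /andP[kk' _] ->; left => /=.
  have k'k : k' != k by rewrite eq_sym.
  by case: o => [f|f i|f i|]; case: b; case: b' => //=;
    case Ek: (f k) => [n|]; case Ek': (f k') => [n'|] //=;
    rewrite ?(upd_other _ _ kk') ?(upd_other _ _ k'k) ?Ek ?Ek' //= upd_comm.
- case/flattenP => _ /mapP[K Kin ->] r0in -> /=.
  by rewrite !acts_cat !acts_pads; exact: point_rule_oeq r0in.
Qed.

(** After an incomplete block, a nonempty code spoils the segment and an empty one would not; both
    sides of a rule must act alike. *)
Lemma letter_rule_neq0 r : r \in letter_rules -> r.1 != [::] /\ r.2 != [::].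
Proof.
rewrite !mem_cat => /or3P[/mapP[l _ ->]|/mapP[t _ ->]|/mapP[r0]] //.
case/flattenP => _ /mapP[K Kin ->]; rewrite /point_rules.
case: (branch k0 K) => [[[k [a Kz]] [b Kt]]|] //.
by rewrite !inE => /orP[] /eqP -> -> //; case: b.
Qed.

(** * An invariant of generator words: counting halting segments *)

Lemma block_size l : size (block l) = #|letter|.+2.
Proof.
by rewrite /= size_cat /= !size_nseq addnS subnKC // ltnW.
Qed.

(** The position of [gD] determines the rank of the letter. *)
Lemma block_inj : injective block.
Proof.
have idxD l : index gD (block l) = (enum_rank l).+1.
  rewrite /= index_cat mem_nseq /= andbF /= size_nseq addn0.
  by [].
by move=> l l' E; apply/enum_rank_inj/val_inj/succn_inj; rewrite -!idxD E.
Qed.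

(* States of the automaton that reads words of generators: the number of
   halting configurations found in the segments between consecutive [gL],
   the letters read since the last [gL], and the incomplete block. *)
Definition gstate := (nat * reading * seq gen)%type.
Implicit Types (t : gstate).

Definition empty_reading := ReadingRegs (fun=> None).

(** A conjugator is an arbitrary generator word, so junk must be read too. It makes the current
    segment malformed, yet [gB] always opens a fresh block and [gL] a fresh segment. *)
Definition gact t (a : gen) : gstate :=
  let: (n, o, buf) := t in
  if a == gL then (n + (halting o && nilp buf), empty_reading, [::])
  else if a == gB then (n, if nilp buf then o else Malformed, [:: gB])
  else if nilp buf then (n, Malformed, [::])
  else if [pick l | block l == rcons buf a] is Some l then (n, act o l, [::])
  else (n, o, rcons buf a).

Notation gacts := (foldl gact).

Lemma gacts_block n o buf l :
  gacts (n, o, buf) (block l) = (n, act (if nilp buf then o else Malformed) l, [::]).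
Proof.
rewrite /block [foldl _ _ _]/=; move: (if nilp buf then o else Malformed) => {buf} o.
set y := _ ++ _.
have: block l = [:: gB] ++ y by [].
have: all (fun a => (a != gL) && (a != gB)) y.
  by rewrite all_cat /= !all_nseq /= !orbT.
have: y != [::] by rewrite /y; case: (nat_of_ord _).
have: [:: gB] != [::] :> seq gen by [].
move: y [:: gB]; elim=> // a y IH pre pre0 _ /= /andP[/andP[aL aB] yall] E.
rewrite (negbTE aL) (negbTE aB); case: pre pre0 E => // b pre _ E; rewrite [nilp _]/=.
case: pickP => [l'|none].
  (* All blocks have the same size, so none is recognised before its last generator. *)
  move=> /eqP El'; have y0 : y = [::].
    have := congr1 size E; rewrite block_size -(block_size l') El' size_rcons size_cat /=.
    by case: (y) => //= ? ?; lia.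
  rewrite y0 /=; congr (_, _, _); congr act; apply: block_inj.
  by rewrite El' E y0 cats1.
have yn0 : y != [::].
  apply/eqP => y0; have := none l; rewrite E y0 cats1 eqxx //.
by apply: (IH (rcons (b :: pre) a)) => //; rewrite E cat_rcons.
Qed.

Lemma gacts_code n o w : gacts (n, o, [::]) (code w) = (n, acts o w, [::]).
Proof.
elim: w o => // l w IH o.
by rewrite -[code (_ :: _)]/(block l ++ code w) foldl_cat gacts_block IH.
Qed.

Lemma gacts_code_junk n o buf w : buf != [::] -> w != [::] ->
  gacts (n, o, buf) (code w) = (n, Malformed, [::]).
Proof.
case: w => // l w; rewrite -size_eq0 => /negbTE b0 _.
rewrite -[code (_ :: _)]/(block l ++ code w) foldl_cat gacts_block /nilp b0 gacts_code.
by congr (_, _, _); rewrite -[RHS](acts_Fail (l :: w)).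
Qed.

Definition geq t t' := [/\ t.1.1 = t'.1.1, oeq t.1.2 t'.1.2 & t.2 = t'.2].

Lemma geq_gact t t' a : geq t t' -> geq (gact t a) (gact t' a).
Proof.
case: t t' => [[n o] buf] [[n' o'] buf'] [/= <- oo' <-]; rewrite /gact.
case: ifP => _; first by split=> //=; [rewrite (oeq_halting oo')|left].
case: ifP => _; first by split=> //=; case: ifP => _ //; left.
case: ifP => _; first by split=> //; left.
by case: pickP => [l _|_]; split=> //=; exact: oeq_act.
Qed.

Lemma geq_gacts t t' x : geq t t' -> geq (gacts t x) (gacts t' x).
Proof. by elim: x t t' => //= a x IH t t' tt'; apply/IH/geq_gact. Qed.

Lemma geq_trans t1 t2 t3 : geq t1 t2 -> geq t2 t3 -> geq t1 t3.
Proof.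
by move=> [h1 h2 h3] [h4 h5 h6]; split; rewrite ?h1 ?h3 //; exact: oeq_trans h5.
Qed.

Lemma oeq_sym o o' : oeq o o' -> oeq o' o.
Proof. by case=> [->|[h1 h2 h3]]; [left|right]. Qed.

Lemma geq_sym t1 t2 : geq t1 t2 -> geq t2 t1.
Proof. by move=> [h1 h2 h3]; split=> //; exact: oeq_sym. Qed.

Lemma geq_refl t : geq t t. Proof. by split=> //; left. Qed.

Lemma rule_geq x y t : (x, y) \in rules -> geq (gacts t x) (gacts t y).
Proof.
case: t => [[n o] buf]; rewrite inE => /orP[/eqP E|/mapP[r rin [-> ->]]].
  have [-> ->] : x = block lP ++ [:: gL] /\ y = [:: gL] ++ block lP by case: E.
  rewrite !foldl_cat gacts_block.
  rewrite [foldl _ (n, o, buf) _]/= gacts_block /=.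
  (* If a block was left incomplete, neither order counts the segment: either [block lP] has made it
     malformed, or [gL] meets a nonempty buffer. *)
  by case: ifP => /= _; rewrite ?andbT ?andbF; exact: geq_refl.
have [r1 r2] := letter_rule_neq0 rin.
case: (altP (buf =P [::])) => [->|b0].
  by rewrite !gacts_code; split=> //=; exact: letter_rule_oeq.
by rewrite !gacts_code_junk //; exact: geq_refl.
Qed.

Lemma cong_geq x y : cong rules x y -> forall t, geq (gacts t x) (gacts t y).
Proof.
elim=> {x y} [x y xy t|x t|x y _ h t|x y z _ h1 _ h2 t|x x' y y' _ h1 _ h2 t].
- exact: rule_geq.
- exact: geq_refl.
- exact/geq_sym/h.
- exact: geq_trans (h1 t) (h2 t).
- rewrite !foldl_cat; apply: (geq_trans (h2 _)); exact/geq_gacts/h1.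
Qed.

(** The segment still open at the end is counted as if [gL] followed. *)
Definition gcount t := t.1.1 + (halting t.1.2 && nilp t.2).

Lemma gacts_shift m n o buf x : gacts (m + n, o, buf) x =
  (m + (gacts (n, o, buf) x).1.1, (gacts (n, o, buf) x).1.2, (gacts (n, o, buf) x).2).
Proof.
elim: x n o buf => //= a x IH n o buf.
case: ifP => _; first by rewrite -addnA IH.
case: ifP => _; first by rewrite IH.
case: ifP => _; first by rewrite IH.
by case: pickP => [l _|_]; rewrite IH.
Qed.

Lemma gacts_word n o buf w : gacts (n, o, buf) (gL :: code w ++ [:: gL]) =
  (n + (halting o && nilp buf) + halting (acts empty_reading w), empty_reading, [::]).
Proof. by rewrite /= foldl_cat gacts_code /= andbT. Qed.

Lemma acts_regs_word s : acts empty_reading (regs_word s) = ReadingRegs (Some \o s).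
Proof.
have gen ks f : uniq ks -> (forall k, k \in ks -> f k = None) ->
    acts (ReadingRegs f) (flatten [seq track s k | k <- ks]) =
    ReadingRegs (fun k => if k \in ks then Some (s k) else f k).
  elim: ks f => // k ks IH f; rewrite cons_uniq => /andP[kks uks] h.
  change (acts (act (ReadingRegs f) (lZ k))
    (nseq (s k) (lT k) ++ flatten [seq track s j | j <- ks]) =
    ReadingRegs (fun j => if j \in k :: ks then Some (s j) else f j)).
  rewrite [act _ _]/= h ?mem_head // acts_cat.
  rewrite (@acts_lT _ _ 0) ?upd_same // upd_upd IH //.
    congr ReadingRegs; apply/funext => j; rewrite inE /upd.
    by case: (j =P k) => [->|_] //=; rewrite (negbTE kks).
  move=> j jks; rewrite upd_other ?h ?inE ?jks ?orbT //.
  by apply: contraNneq kks => <-.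
rewrite gen ?enum_uniq //; congr ReadingRegs; apply/funext => k.
by rewrite mem_enum.
Qed.

Lemma acts_config_word K s :
  acts empty_reading (config_word K s) = Parsed (Some \o s) (idx K).
Proof. by rewrite acts_cat acts_regs_word acts_state_word. Qed.

Lemma geq_gcount t t' : geq t t' -> gcount t = gcount t'.
Proof. by rewrite /gcount => -[-> /oeq_halting -> ->]. Qed.

(* In [xg = gy] the segments strictly inside [g] contribute equally to both
   sides, so [x] and [y] contribute equally. *)
Lemma terminates_of_oconj s :
  oconj (word_class rules (start_word s)) (word_class rules (final_word s)) ->
  terminates k0 ([:: U], s).
Proof.
case=> [G [h [+ _]]]; have [g ->] := pi_surj G.
rewrite -[\pi_(pres_monoid rules)%qT g]/(word_class rules g) !word_classM.
move/pres_eqP/cong_geq/(_ (0, empty_reading, [::]))/geq_gcount.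
rewrite !foldl_cat gacts_word acts_config_word halting_config ?start_points //.
(* On both sides [g] is now read from the same state, up to the contribution of the start word to
   the counter. *)
rewrite -[0 + _ + _]addnC gacts_shift.
case: (gacts (0, empty_reading, [::]) g) => [[n o] buf].
rewrite gacts_word acts_cat acts_config_word acts_pads halting_config ?inE //.
have -> : `[< terminates k0 ([::], fun=> 0) >] = true.
  by apply/asboolP; exists (fun=> 0); exact: reach_refl.
rewrite /gcount /=; case: asboolP => // _.
by case: (halting o && nilp buf) => /=; lia.
Qed.

End MonoidOfProgram.

(** * Programs on positional stacks *)

Ltac drop_neqs :=
  repeat match goal with
  | H : is_true (~~ (@eq_op ?T _ _)) |- _ =>
      assert_fails (unify (Equality.sort T) nat); clear H
  end.

Ltac upd_cases :=
  let j := fresh "j" in apply/funext => j; rewrite /upd;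
  repeat (let H := fresh "jE" in case: eqP => H;
    [subst; try match goal with H : is_true (?a != ?a) |- _ => by rewrite eqxx in H end
    |clear H]);
  try done; drop_neqs; lia.

Section Macros.
Variables (R : eqType) (k0 : R).
Implicit Types (s : R -> nat) (p : prog R).
Notation exec := (executes k0).

Lemma exec_env p s s1 s2 : s1 = s2 -> exec p s s1 -> exec p s s2.
Proof. by move=> ->. Qed.

Lemma exec_start p s1 s2 s : s1 = s2 -> exec p s1 s -> exec p s2 s.
Proof. by move=> ->. Qed.

Definition clear (k : R) := While k (Dec k).
Definition transfer (a c : R) := While a (Seq (Dec a) (Inc c)).
Definition copy_via (u a c : R) :=
  Seq (While a (Seq (Dec a) (Seq (Inc c) (Inc u)))) (transfer u a).

Lemma exec_clear k s : exec (clear k) s (upd s k 0).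
Proof.
move E: (s k) => n; elim: n s E => [|n IH] s E.
  by rewrite upd_test0 //; exact: exec_while0.
apply: (@exec_whileS _ _ _ _ _ (upd s k n)); rewrite ?E //.
  by apply: exec_env (exec_dec _ _ _); rewrite E.
by apply: exec_env (IH _ _); rewrite ?upd_upd ?upd_same.
Qed.

Lemma exec_transfer a c s : a != c ->
  exec (transfer a c) s (upd (upd s c (s c + s a)) a 0).
Proof.
move=> ac; have ca : c != a by rewrite eq_sym.
move E: (s a) => n; elim: n s E => [|n IH] s E.
  by rewrite addn0 upd_id upd_test0 //; exact: exec_while0.
apply: (@exec_whileS _ _ _ _ _ (upd (upd s a n) c (s c).+1)); rewrite ?E //.
  apply: exec_seq (exec_dec _ _ _) _; apply: exec_env (exec_inc _ _ _).
  by rewrite E /= (upd_other _ _ ca).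
apply: exec_env (IH _ _); rewrite ?upd_same ?(upd_other _ _ ac) ?upd_same //.
by rewrite upd_upd (upd_comm _ _ _ ac) upd_upd addSnnS.
Qed.

Lemma exec_copy u a c s : u != a -> u != c -> a != c -> s u = 0 ->
  exec (copy_via u a c) s (upd s c (s c + s a)).
Proof.
move=> ua uc ac u0; have ca : c != a by rewrite eq_sym.
have au : a != u by rewrite eq_sym.
have cu : c != u by rewrite eq_sym.
apply: (@exec_seq _ _ _ _ _ (upd (upd (upd s c (s c + s a)) u (s u + s a)) a 0)).
  move E: (s a) => n; elim: n s {u0} E => [|n IH] s E.
    by rewrite !addn0 !upd_id upd_test0 //; exact: exec_while0.
  apply: (@exec_whileS _ _ _ _ _
    (upd (upd (upd s a n) c (s c).+1) u (s u).+1)); rewrite ?E //.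
    apply: exec_seq (exec_dec _ _ _) _; apply: exec_seq (exec_inc _ _ _) _.
    apply: exec_env (exec_inc _ _ _).
    by rewrite E /= !(upd_same, upd_other).
  apply: exec_env (IH _ _); rewrite !(upd_same, upd_other) //.
  upd_cases.
apply: exec_env (exec_transfer _ ua).
rewrite !(upd_same, upd_other) // add0n; upd_cases.
Qed.

(* Numbers written in the base held by register [b] serve as stacks: [push_digit]
   puts the content of [x] on top of [k], [pop_digit] moves the top digit to [x]. *)
Definition push_digit (b x u k : R) := Seq (While k (Seq (Dec k) (copy_via u b x))) (transfer x k).
Definition pop_digit (b x u k : R) :=
  Seq (While k (Seq (Dec k) (Seq (Dec b) (Seq (Inc x)
        (IfZ b (Seq (transfer x b) (Inc u)))))))
      (Seq (transfer u k) (copy_via u x b)).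

(** Each unit removed from [k] adds a copy of [b] to [x], which already holds the new digit. *)
Lemma exec_push b x u k s : uniq [:: b; x; u; k] -> s u = 0 ->
  exec (push_digit b x u k) s (upd (upd s k (s x + s b * s k)) x 0).
Proof.
move=> /= /and4P[]; rewrite !inE !negb_or => /and3P[bx bu bk] /andP[xu xk] uk _ u0.
have [xb ub kb] : [/\ x != b, u != b & k != b] by split; rewrite eq_sym.
have [ux kx ku] : [/\ u != x, k != x & k != u] by split; rewrite eq_sym.
apply: (@exec_seq _ _ _ _ _ (upd (upd s x (s x + s b * s k)) k 0)).
  move E: (s k) => n; elim: n s E u0 => [|n IH] s E u0.
    by rewrite muln0 addn0 upd_id upd_test0 //; exact: exec_while0.
  apply: (@exec_whileS _ _ _ _ _ (upd (upd s k n) x (s x + s b))); rewrite ?E //.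
    apply: exec_seq (exec_dec _ _ _) _; rewrite E.
    by apply: exec_env (exec_copy _ _ _ _); rewrite ?(upd_same, upd_other).
  apply: exec_env (IH _ _ _); rewrite ?(upd_same, upd_other) //.
  upd_cases.
apply: exec_env (exec_transfer _ xk).
rewrite !(upd_same, upd_other) // add0n; upd_cases.
Qed.

(** Division by counting: units move from [k] to [x] while [b] counts down; when [b] reaches 0 it is
    restored from [x] and the quotient in [u] grows. *)
Lemma exec_pop b x u k s : uniq [:: b; x; u; k] -> s u = 0 -> s x = 0 -> 0 < s b ->
  exec (pop_digit b x u k) s (upd (upd s k (s k %/ s b)) x (s k %% s b)).
Proof.
move=> /= /and4P[]; rewrite !inE !negb_or => /and3P[bx bu bk] /andP[xu xk] uk _.
move=> u0 x0 b0.
have [xb ub kb] : [/\ x != b, u != b & k != b] by split; rewrite eq_sym.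
have [ux kx ku] : [/\ u != x, k != x & k != u] by split; rewrite eq_sym.
(* Here [n] is what remains of [k], [q] the quotient so far and [i] the partial remainder; [b] and
   [x] always add up to the base. *)
pose loop n q i := upd (upd (upd (upd s k n) u q) x i) b (s b - i).
have step n q i : i < s b -> exec
    (While k (Seq (Dec k) (Seq (Dec b) (Seq (Inc x)
        (IfZ b (Seq (transfer x b) (Inc u)))))))
    (loop n q i) (loop 0 (q + (i + n) %/ s b) ((i + n) %% s b)).
  elim: n q i => [|n IH] q i ib.
    rewrite addn0 divn_small // modn_small // addn0; apply: exec_while0.
    by rewrite /loop !(upd_same, upd_other).
  apply: (@exec_whileS _ _ _ _ _
    (if i.+1 == s b then loop n q.+1 0 else loop n q i.+1)).
  - by rewrite /loop !(upd_same, upd_other).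
  - apply: exec_seq (exec_dec _ _ _) _; apply: exec_seq (exec_dec _ _ _) _.
    apply: exec_seq (exec_inc _ _ _) _.
    apply: (@exec_start _ (loop n q i.+1)).
      rewrite /loop !(upd_same, upd_other) //; upd_cases.
    case: eqP => [E|/eqP E]; last first.
      by apply: exec_ifzS; rewrite /loop upd_same; drop_neqs; lia.
    apply: exec_ifz0; first by rewrite /loop upd_same; drop_neqs; lia.
    apply: exec_seq (exec_transfer _ xb) _; apply: exec_env (exec_inc _ _ _).
    rewrite /loop !(upd_same, upd_other) //; upd_cases.
  - case: eqP => [E|/eqP E].
      apply: exec_env (IH _ _ b0); rewrite add0n addnS -addSn E.
      by rewrite divnDl ?dvdnn // divnn b0 modnDl addnA addn1.
    by rewrite addnS -addSn; apply: IH; drop_neqs; lia.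
apply: (@exec_start _ (loop (s k) 0 0)).
  by rewrite /loop; upd_cases.
apply: exec_seq (step _ _ _ b0) _; rewrite !add0n.
apply: exec_seq (exec_transfer _ uk) _.
(* This bound makes the truncated subtraction in [loop] exact, so adding [x] back restores the
   base. *)
have lt : s k %% s b < s b by rewrite ltn_mod.
apply: exec_env (exec_copy _ _ _ _); rewrite /loop ?(upd_same, upd_other) //.
upd_cases.
Qed.
End Macros.

(** * The universal program *)

(** Roles: [rP] table, [rB] base, [rL] and [rR] the two halves of the tape, [rS] state and then
    table position, [rX] current digit, [rM] flag to continue, [rT] consumable copy of the table,
    [rD] loop counter, [rU] scratch. *)
Inductive reg := rP | rB | rL | rR | rS | rX | rM | rT | rD | rU.

Definition regs := [:: rP; rB; rL; rR; rS; rX; rM; rT; rD; rU].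

Definition reg_nat (k : reg) : nat :=
  match k with
  | rP => 0 | rB => 1 | rL => 2 | rR => 3 | rS => 4
  | rX => 5 | rM => 6 | rT => 7 | rD => 8 | rU => 9
  end.

Lemma reg_natK : pcancel reg_nat (nth None (map Some regs)).
Proof. by case. Qed.

HB.instance Definition _ := Countable.copy reg (pcan_type reg_natK).

Lemma regs_enumP : Finite.axiom regs. Proof. by case. Qed.

HB.instance Definition _ := isFinite.Build reg regs_enumP.

Notation exec := (executes rX).
Notation push := (push_digit rB rX rU).
Notation pop := (pop_digit rB rX rU).
Notation copy := (copy_via rU).
Notation input_symbol := (option gen).

Infix ";;" := Seq (at level 60, right associativity).

(* Symbol codes are multiples of [5], the length of a record of the
   transition table; the blank has code [0]. *)
Definition input_code (i : input_symbol) : nat := 5 * (index i (enum {: input_symbol})).+1.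

Definition emit_symbol i := iter (input_code i) (Seq (Inc rX)) (push rR).
(** The tape is a stack, so the last symbol is pushed first. As [rU] is 0 between macros, [Dec rU]
    does nothing. *)
Definition emit w := foldr (fun i p => p ;; emit_symbol i) (Dec rU) w.
Definition emit_copies k w := copy k rD ;; While rD (Dec rD ;; emit w).

Definition some_word (w : seq gen) : seq input_symbol := map Some w.

Definition emit_track (k : reg) :=
  (if k \in [:: rP; rB] then emit_copies k (some_word (block (lT k))) else Dec rU) ;;
  emit (some_word (block (lZ k))).
Definition emit_tracks ks := foldr (fun k p => p ;; emit_track k) (Dec rU) ks.

(** The part of the text that is independent of [rP] and [rB]. Its state words have the fixed
    exponents 1 and 0, so [universal] can write its own start and final words without referring to
    itself. *)
Definition middle_text : seq input_symbol :=
  some_word (code [:: lH reg; lE reg; lF reg] ++ [:: gL]) ++ None ::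
  some_word (gL :: code (regs_word (fun=> 0) ++ [:: lH reg; lF reg])).

(** Written from right to left. The final word carries one padding letter for each unit of [rP] and
    [rB], and one more for the extra [lE] of the start state. *)
Definition write_input :=
  emit (some_word (block (lP reg) ++ [:: gL])) ;;
  emit_copies rB (some_word (block (lP reg))) ;;
  emit_copies rP (some_word (block (lP reg))) ;;
  emit middle_text ;;
  emit_tracks (enum {: reg}) ;;
  emit [:: Some gL].

(** State code plus symbol code is the position of a record in the table, so that many digits are
    skipped and the next five are executed. *)
Definition simulate_step :=
  Dec rM ;; pop rR ;; transfer rX rS ;; copy rP rT ;;
  While rS (Dec rS ;; pop rT ;; clear rX) ;;
  pop rT ;; push rR ;;
  pop rT ;; transfer rX rD ;; While rD (Dec rD ;; pop rR ;; push rL) ;;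
  pop rT ;; transfer rX rD ;; While rD (Dec rD ;; pop rL ;; push rR) ;;
  pop rT ;; transfer rX rS ;;
  pop rT ;; transfer rX rM ;;
  clear rT.

(** The final word describes zero registers, so a halting run must erase everything, table and base
    included. *)
Definition clear_all := foldr (fun k p => clear k ;; p) (clear rU) (enum {: reg}).

Definition universal :=
  write_input ;; Inc rM ;; While rM simulate_step ;; clear_all.

Lemma exec_clear_all s : exec clear_all s (fun=> 0).
Proof.
rewrite /clear_all.
have gen ks s' : exec (foldr (fun k p => clear k ;; p) (clear rU) ks) s'
    (fun j => if (j \in ks) || (j == rU) then 0 else s' j).
  elim: ks s' => [|k ks IH] s' /=; first exact: exec_clear.
  apply: exec_seq (exec_clear _ _ _) _; apply: exec_env (IH _).
  apply/funext => j; rewrite inE /upd.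
  by case: (j =P k) => //= _; case: ifP.
apply: exec_env (gen _ _); apply/funext => j.
by rewrite mem_enum.
Qed.

(** * Effect of the macros on the ten registers *)

Section Registers.
Variables (vP vB : nat).

Definition regs_val l r s x m t d : reg -> nat := fun k =>
  match k with
  | rP => vP | rB => vB | rL => l | rR => r | rS => s
  | rX => x | rM => m | rT => t | rD => d | rU => 0
  end.

Ltac reg_cases := apply/funext; case; rewrite /upd //=.

Hypothesis vB_gt0 : 0 < vB.
Variables (l r s x m t d : nat).

Lemma exec_popR : exec (pop rR) (regs_val l r s 0 m t d)
  (regs_val l (r %/ vB) s (r %% vB) m t d).
Proof. by apply: exec_env (exec_pop _ _ _ _ _) => //; reg_cases. Qed.

Lemma exec_popL : exec (pop rL) (regs_val l r s 0 m t d)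
  (regs_val (l %/ vB) r s (l %% vB) m t d).
Proof. by apply: exec_env (exec_pop _ _ _ _ _) => //; reg_cases. Qed.

Lemma exec_popT : exec (pop rT) (regs_val l r s 0 m t d)
  (regs_val l r s (t %% vB) m (t %/ vB) d).
Proof. by apply: exec_env (exec_pop _ _ _ _ _) => //; reg_cases. Qed.

Lemma exec_pushR : exec (push rR) (regs_val l r s x m t d)
  (regs_val l (x + vB * r) s 0 m t d).
Proof. by apply: exec_env (exec_push _ _ _) => //; reg_cases. Qed.

Lemma exec_pushL : exec (push rL) (regs_val l r s x m t d)
  (regs_val (x + vB * l) r s 0 m t d).
Proof. by apply: exec_env (exec_push _ _ _) => //; reg_cases. Qed.

Lemma exec_XS : exec (transfer rX rS) (regs_val l r s x m t d)
  (regs_val l r (s + x) 0 m t d).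
Proof. by apply: exec_env (exec_transfer _ _ _) => //; reg_cases. Qed.

Lemma exec_XD : exec (transfer rX rD) (regs_val l r s x m t d)
  (regs_val l r s 0 m t (d + x)).
Proof. by apply: exec_env (exec_transfer _ _ _) => //; reg_cases. Qed.

Lemma exec_XM : exec (transfer rX rM) (regs_val l r s x m t d)
  (regs_val l r s 0 (m + x) t d).
Proof. by apply: exec_env (exec_transfer _ _ _) => //; reg_cases. Qed.

Lemma exec_PT : exec (copy rP rT) (regs_val l r s x m t d)
  (regs_val l r s x m (t + vP) d).
Proof. by apply: exec_env (exec_copy _ _ _ _ _) => //; reg_cases. Qed.

Lemma exec_copyD k : k \in [:: rP; rB] ->
  exec (copy k rD) (regs_val l r s x m t d)
  (regs_val l r s x m t (d + regs_val 0 0 0 0 0 0 0 k)).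
Proof.
by rewrite !inE => /orP[] /eqP ->;
  apply: exec_env (exec_copy _ _ _ _ _) => //; reg_cases.
Qed.

Lemma exec_clearX : exec (clear rX) (regs_val l r s x m t d) (regs_val l r s 0 m t d).
Proof. by apply: exec_env (exec_clear _ _ _) => //; reg_cases. Qed.

Lemma exec_clearT : exec (clear rT) (regs_val l r s x m t d) (regs_val l r s x m 0 d).
Proof. by apply: exec_env (exec_clear _ _ _) => //; reg_cases. Qed.

Lemma exec_decM : exec (Dec rM) (regs_val l r s x m t d) (regs_val l r s x m.-1 t d).
Proof. by apply: exec_env (exec_dec _ _ _) => //; reg_cases. Qed.

Lemma exec_incM : exec (Inc rM) (regs_val l r s x m t d) (regs_val l r s x m.+1 t d).
Proof. by apply: exec_env (exec_inc _ _ _) => //; reg_cases. Qed.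

Lemma exec_decS : exec (Dec rS) (regs_val l r s x m t d) (regs_val l r s.-1 x m t d).
Proof. by apply: exec_env (exec_dec _ _ _) => //; reg_cases. Qed.

Lemma exec_decD : exec (Dec rD) (regs_val l r s x m t d) (regs_val l r s x m t d.-1).
Proof. by apply: exec_env (exec_dec _ _ _) => //; reg_cases. Qed.

Lemma exec_decU : exec (Dec rU) (regs_val l r s x m t d) (regs_val l r s x m t d).
Proof. by apply: exec_env (exec_dec _ _ _) => //; reg_cases. Qed.

Lemma exec_incX : exec (Inc rX) (regs_val l r s x m t d) (regs_val l r s x.+1 m t d).
Proof. by apply: exec_env (exec_inc _ _ _) => //; reg_cases. Qed.

End Registers.

(** * Writing the pair of words on the simulated tape *)

Section Emission.
Variables (vP vB : nat).

Definition prepend b (w : seq input_symbol) r :=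
  foldr (fun i r => input_code i + b * r) r w.
Notation st r d := (regs_val vP vB 0 r 0 0 0 0 d).

Lemma prepend_cat b w1 w2 r :
  prepend b (w1 ++ w2) r = prepend b w1 (prepend b w2 r).
Proof. exact: foldr_cat. Qed.

Definition writes p w d := forall r, exec p (st r d) (st (prepend vB w r) d).

Lemma writes_symbol i d : writes (emit_symbol i) [:: i] d.
Proof.
move=> r.
have gen n x : exec (iter n (Seq (Inc rX)) (push rR)) (regs_val vP vB 0 r 0 x 0 0 d)
    (st (x + n + vB * r) d).
  elim: n x => [|n IH] x /=; first by rewrite addn0; exact: exec_pushR.
  by apply: exec_seq (exec_incX _ _ _ _ _ _ _ _ _) _; rewrite -addSnnS; exact: IH.
by apply: exec_env (gen (input_code i) 0); rewrite add0n.
Qed.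

Lemma writes_seq p q w1 w2 d : writes p w1 d -> writes q w2 d ->
  writes (p ;; q) (w2 ++ w1) d.
Proof. by move=> h1 h2 r; rewrite prepend_cat; apply: exec_seq (h1 _) (h2 _). Qed.

Lemma writes_nil d : writes (Dec rU) [::] d.
Proof. by move=> r; exact: exec_decU. Qed.

Lemma writes_emit w d : writes (emit w) w d.
Proof.
elim: w => [|i w IH]; first exact: writes_nil.
by rewrite -[i :: w]/([:: i] ++ w); apply: writes_seq (writes_symbol _ _).
Qed.

Lemma writes_copies k w : k \in [:: rP; rB] ->
  writes (emit_copies k w) (flatten (nseq (regs_val vP vB 0 0 0 0 0 0 0 k) w)) 0.
Proof.
move=> kin r; apply: exec_seq (exec_copyD _ _ _ _ _ _ _ _ _ kin) _; rewrite add0n.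
elim: (regs_val _ _ _ _ _ _ _ _ _ k) r => [|n IH] r; first exact: exec_while0.
apply: exec_whileS; [by []| |].
  by apply: exec_seq (exec_decD _ _ _ _ _ _ _ _ _) _; exact: writes_emit.
apply: exec_env (IH _); rewrite -prepend_cat -addn1 nseqD flatten_cat /=.
by rewrite cats0.
Qed.

Definition input_regs : reg -> nat := regs_val vP vB 0 0 0 0 0 0 0.

Lemma input_regs0 k : k \notin [:: rP; rB] -> input_regs k = 0.
Proof. by case: k. Qed.

Lemma some_word_cat u v : some_word (u ++ v) = some_word u ++ some_word v.
Proof. exact: map_cat. Qed.

Lemma some_word_copies n l :
  some_word (code (nseq n l)) = flatten (nseq n (some_word (@block reg l))).
Proof. by elim: n => // n IH; rewrite -[LHS]/(some_word (_ ++ _)) some_word_cat IH. Qed.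

Lemma writes_track k : writes (emit_track k) (some_word (code (track input_regs k))) 0.
Proof.
have -> : some_word (code (track input_regs k)) =
    some_word (block (lZ k)) ++ some_word (code (nseq (input_regs k) (lT k))).
  by rewrite -some_word_cat.
apply: writes_seq (writes_emit _ _).
case: ifPn => [kin|/input_regs0 ->]; last exact: writes_nil.
by rewrite some_word_copies; exact: writes_copies.
Qed.

Lemma writes_tracks ks :
  writes (emit_tracks ks) (some_word (code (flatten [seq track input_regs k | k <- ks]))) 0.
Proof.
elim: ks => [|k ks IH]; first exact: writes_nil.
rewrite map_cons -[flatten (_ :: _)]/(_ ++ _) code_cat some_word_cat.
by apply: writes_seq => //; exact: writes_track.
Qed.

Definition input_text : seq input_symbol :=
  pair_input (start_word universal input_regs) (final_word universal input_regs).

Lemma final_pads_input :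
  size (start_letters universal input_regs) -
    size (config_word universal [::] (fun=> 0)) = vP + vB + 1.
Proof.
rewrite final_pads -addn1; congr (_ + _).
have E : enum {: reg} = regs by rewrite enumT unlock.
by rewrite -big_enum E /= !big_cons big_nil /= !addn0.
Qed.

Lemma input_text_split : input_text = some_word [:: gL] ++
  some_word (code (regs_word input_regs)) ++ middle_text ++
  flatten (nseq vP (some_word (block (lP reg)))) ++
  flatten (nseq vB (some_word (block (lP reg)))) ++
  some_word (block (lP reg) ++ [:: gL]).
Proof.
have regroup (a b c d e : seq (letter reg)) :
    some_word ([:: gL] ++ code (a ++ b) ++ [:: gL]) ++ [:: None] ++
    some_word ([:: gL] ++ code (c ++ d ++ e) ++ [:: gL]) =
    some_word [:: gL] ++ some_word (code a) ++
    (some_word (code b ++ [:: gL]) ++ [:: None] ++ some_word ([:: gL] ++ code c)) ++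
    some_word (code d) ++ some_word (code e ++ [:: gL]).
  by rewrite !code_cat !some_word_cat -!catA.
rewrite /input_text /pair_input /start_word /final_word /final_letters.
rewrite final_pads_input /start_letters /config_word.
rewrite /state_word idx_nil [idx _ [:: _]]points_start.
rewrite (catA (flatten _) (flatten _)) -!some_word_copies -some_word_cat -code_cat.
rewrite -(nseqD vP vB) [in LHS](nseqD (vP + vB) 1).
have <- : code [:: lP reg] = block (lP reg) by exact: cats0.
exact: (regroup _ [:: lH reg; lE reg; lF reg] _ _ [:: lP reg]).
Qed.

Lemma writes_input : writes write_input input_text 0.
Proof.
rewrite input_text_split 4!catA.
apply: writes_seq; first exact: writes_emit.
apply: writes_seq; first exact: (@writes_copies rB).
apply: writes_seq; first exact: (@writes_copies rP).
apply: writes_seq; first exact: writes_emit.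
apply: writes_seq; [exact: writes_tracks|exact: writes_emit].
Qed.

End Emission.

(** * Simulating a Turing machine from its table *)

Section Simulation.
Variable M : tm input_symbol.
Notation sym := (option (input_symbol + work M)).

(** The blank comes first because popping an empty stack yields 0, and likewise [states] begins with
    the start state because [rS] is initially 0. *)
Definition symbols : seq sym :=
  None :: [seq Some (inl i) | i <- enum {: input_symbol}] ++
          [seq Some (inr w) | w <- enum (work M)].
Definition states : seq (state M) := start M :: enum (state M).

Definition row := 5 * size symbols.
Definition symbol_code (a : sym) := 5 * index a symbols.
Definition state_code (q : state M) := row * index q states.

Lemma mem_symbols a : a \in symbols.
Proof.
rewrite inE mem_cat; case: a => [[i|w]|] //=.
- by rewrite map_f ?mem_enum.
- by rewrite (map_f (fun w => Some (inr w))) ?mem_enum ?orbT.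
Qed.

Lemma mem_states q : q \in states.
Proof. by rewrite inE mem_enum orbT. Qed.

Lemma symbol_code_input i : symbol_code (Some (inl i)) = input_code i.
Proof.
rewrite /symbol_code /input_code /=; congr (5 * _.+1).
rewrite index_cat mem_map; last by move=> ? ? [].
by rewrite mem_enum index_map // => ? ? [].
Qed.

Lemma state_code_start : state_code (start M) = 0.
Proof. by rewrite /state_code /= eqxx muln0. Qed.

(* Symbol to write, number of moves to the right, number of moves to the left,
   new state, and whether to continue. An accepting halt becomes an infinite
   loop. *)
Definition record q a : seq nat :=
  match trans q a with
  | Some (q', a', m) =>
      [:: symbol_code a'; nat_of_bool (if m is Right then true else false);
          nat_of_bool (if m is Left then true else false); state_code q'; 1]
  | None => [:: symbol_code a; 0; 0; state_code q; nat_of_bool (accepting q)]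
  end.

Definition table_size := row * size states.
Definition table := mkseq (fun i => nth 0
  (record (nth (start M) states (i %/ row))
          (nth None symbols ((i %/ 5) %% size symbols))) (i %% 5)) table_size.

(** Large enough for every symbol code, state code and flag to be a single digit. *)
Definition base := table_size.+2.

Lemma symbol_code_row a : symbol_code a + 5 <= row.
Proof. by rewrite /symbol_code /row -mulnSr leq_mul2l index_mem mem_symbols. Qed.

Lemma state_code_row q : state_code q + row <= table_size.
Proof.
by rewrite /state_code /table_size -mulnSr leq_mul2l index_mem mem_states orbT.
Qed.

Lemma table_nth q a j : j < 5 ->
  nth 0 table (state_code q + symbol_code a + j) = nth 0 (record q a) j.
Proof.
move=> j5; have ha := symbol_code_row a; have hq := state_code_row q.
rewrite /table nth_mkseq; last by lia.
have row0 : 0 < row by rewrite /row.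
have -> : (state_code q + symbol_code a + j) %/ row = index q states.
  by rewrite -addnA /state_code mulnC divnMDl // divn_small ?addn0 //; lia.
have E : state_code q + symbol_code a + j =
    (index q states * size symbols + index a symbols) * 5 + j.
  by rewrite /state_code /symbol_code /row; lia.
rewrite {}E divnMDl // (divn_small j5) addn0 (modnMDl _ j) (modn_small j5).
by rewrite modnMDl modn_small ?index_mem ?mem_symbols // !nth_index ?mem_states ?mem_symbols.
Qed.

Definition encode (l : seq nat) := foldr (fun a r => a + base * r) 0 l.

Lemma encode_divmod l : all (fun a => a < base) l ->
  encode l %% base = head 0 l /\ encode l %/ base = encode (behead l).
Proof.
case: l => [|a l] /=; first by rewrite mod0n div0n.
by case/andP => h _; rewrite mulnC addnC modnMDl modn_small // divnMDl // divn_small // addn0.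
Qed.

Lemma table_bound i : all (fun a => a < base) (drop i table).
Proof.
apply/allP => x /mem_drop /mapP[j _ ->]; cbv beta; rewrite /record.
set q := nth (start M) _ _; set a := nth None _ _; move: (j %% 5) => k.
case: trans => [[[q' a'] m]|].
- have := symbol_code_row a'; have := state_code_row q'; rewrite /base => ? ?.
  by case: k => [|[|[|[|[|k]]]]]; case: m; rewrite /= ?nth_nil; lia.
- have := symbol_code_row a; have := state_code_row q; rewrite /base => ? ?.
  by case: k => [|[|[|[|[|k]]]]]; case: accepting; rewrite /= ?nth_nil; lia.
Qed.

Lemma table_digit i : encode (drop i table) %% base = nth 0 table i /\
  encode (drop i table) %/ base = encode (drop i.+1 table).
Proof.
have [-> ->] := encode_divmod (table_bound i).
by rewrite -nth0 nth_drop addn0 -drop1 drop_drop add1n.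
Qed.

Definition tape (l : seq sym) := encode (map symbol_code l).

Lemma tape_divmod l :
  tape l %% base = symbol_code (head None l) /\ tape l %/ base = tape (behead l).
Proof.
have h : all (fun a => a < base) (map symbol_code l).
  apply/allP => x /mapP[a _ ->]; rewrite /base.
  by have := symbol_code_row a; have := state_code_row (start M); lia.
have [-> ->] := encode_divmod h; rewrite /tape.
by case: l {h} => //=; rewrite /symbol_code muln0.
Qed.

Notation vals := (regs_val (encode table) base).
Definition config_regs (c : config M) m :=
  vals (tape (cells_left c)) (tape (cells_right c)) (state_code (cstate c)) 0 m 0 0.

Definition next (c : config M) :=
  if step c is Some c' then (c', 1) else (c, nat_of_bool (accepting (cstate c))).

Lemma base_gt0 : 0 < base. Proof. by []. Qed.

Lemma exec_skip_digits l r s i : exec (While rS (Dec rS ;; pop rT ;; clear rX))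
  (vals l r s 0 0 (encode (drop i table)) 0)
  (vals l r 0 0 0 (encode (drop (i + s) table)) 0).
Proof.
elim: s i => [|s IH] i; first by rewrite addn0; exact: exec_while0.
apply: exec_whileS; [by []| |by rewrite addnS -addSn; exact: IH].
apply: exec_seq (exec_decS _ _ _ _ _ _ _ _ _) _.
apply: exec_seq (exec_popT _ base_gt0 _ _ _ _ _ _) _.
by rewrite (table_digit i).2; exact: exec_clearX.
Qed.

Lemma exec_next_digit l r s m d i : exec (pop rT)
  (vals l r s 0 m (encode (drop i table)) d)
  (vals l r s (nth 0 table i) m (encode (drop i.+1 table)) d).
Proof. by have [<- <-] := table_digit i; exact: exec_popT. Qed.

Lemma exec_move_right (b : bool) l r t : exec (While rD (Dec rD ;; pop rR ;; push rL))
  (vals l r 0 0 0 t b)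
  (vals (if b then r %% base + base * l else l) (if b then r %/ base else r) 0 0 0 t 0).
Proof.
case: b; last exact: exec_while0.
apply: exec_whileS; [by []| |exact: exec_while0].
apply: exec_seq (exec_decD _ _ _ _ _ _ _ _ _) _.
by apply: exec_seq (exec_popR _ base_gt0 _ _ _ _ _ _) _; exact: exec_pushL.
Qed.

Lemma exec_move_left (b : bool) l r t : exec (While rD (Dec rD ;; pop rL ;; push rR))
  (vals l r 0 0 0 t b)
  (vals (if b then l %/ base else l) (if b then l %% base + base * r else r) 0 0 0 t 0).
Proof.
case: b; last exact: exec_while0.
apply: exec_whileS; [by []| |exact: exec_while0].
apply: exec_seq (exec_decD _ _ _ _ _ _ _ _ _) _.
by apply: exec_seq (exec_popL _ base_gt0 _ _ _ _ _ _) _; exact: exec_pushR.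
Qed.

Lemma exec_record q a l r y (b1 b2 : bool) s' m' :
  r %% base = symbol_code a -> record q a = [:: y; nat_of_bool b1; nat_of_bool b2; s'; m'] ->
  let r1 := y + base * (r %/ base) in
  let l2 := if b1 then r1 %% base + base * l else l in
  let r2 := if b1 then r1 %/ base else r1 in
  exec simulate_step (vals l r (state_code q) 0 1 0 0)
    (vals (if b2 then l2 %/ base else l2) (if b2 then l2 %% base + base * r2 else r2)
          s' 0 m' 0 0).
Proof.
move=> ra E r1 l2 r2.
have digit j : j < 5 -> nth 0 table (state_code q + symbol_code a + j) = nth 0 (record q a) j.
  exact: table_nth.
rewrite {}E in digit.
apply: exec_seq (exec_decM _ _ _ _ _ _ _ _ _) _.
apply: exec_seq (exec_popR _ base_gt0 _ _ _ _ _ _) _.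
apply: exec_seq (exec_XS _ _ _ _ _ _ _ _ _) _.
apply: exec_seq (exec_PT _ _ _ _ _ _ _ _ _) _.
rewrite ra; have -> : 0 + encode table = encode (drop 0 table) by rewrite drop0.
apply: exec_seq (exec_skip_digits _ _ _ _) _; rewrite add0n.
move: (state_code q + symbol_code a) digit => i digit.
have [h0 h1 h2 h3 h4] : [/\ nth 0 table i = y, nth 0 table i.+1 = b1,
    nth 0 table i.+2 = b2, nth 0 table i.+3 = s' & nth 0 table i.+4 = m'].
  by split; [rewrite -[i]addn0 (digit 0)|rewrite -addn1 (digit 1)|
    rewrite -addn2 (digit 2)|rewrite -addn3 (digit 3)|rewrite -addn4 (digit 4)].
apply: exec_seq (exec_next_digit _ _ _ _ _ _) _; rewrite h0.
apply: exec_seq (exec_pushR _ _ _ _ _ _ _ _ _) _.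
apply: exec_seq (exec_next_digit _ _ _ _ _ _) _; rewrite h1.
apply: exec_seq (exec_XD _ _ _ _ _ _ _ _ _) _.
apply: exec_seq (exec_move_right _ _ _ _) _.
apply: exec_seq (exec_next_digit _ _ _ _ _ _) _; rewrite h2.
apply: exec_seq (exec_XD _ _ _ _ _ _ _ _ _) _.
apply: exec_seq (exec_move_left _ _ _ _) _.
apply: exec_seq (exec_next_digit _ _ _ _ _ _) _; rewrite h3.
apply: exec_seq (exec_XS _ _ _ _ _ _ _ _ _) _.
apply: exec_seq (exec_next_digit _ _ _ _ _ _) _; rewrite h4.
apply: exec_seq (exec_XM _ _ _ _ _ _ _ _ _) _.
exact: exec_clearT.
Qed.

Lemma tape_cons a l : tape (a :: l) = symbol_code a + base * tape l.
Proof. by []. Qed.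

(** Blanks beyond the end of the list are digits 0, so an empty half tape and a single blank have
    the same value. *)
Lemma tape_head_behead l : tape (head None l :: behead l) = tape l.
Proof.
case: l => [|//]; rewrite tape_cons -[tape (behead _)]/0 muln0 addn0.
by rewrite /symbol_code /= muln0.
Qed.

Lemma exec_simulate_step c :
  exec simulate_step (config_regs c 1) (config_regs (next c).1 (next c).2).
Proof.
case: c => q l r; rewrite /config_regs /next /step.
rewrite -[cstate _]/q -[cells_left (Config _ _ _)]/l -[cells_right (Config _ _ _)]/r.
have [hm hd] := tape_divmod r; have [lm ld] := tape_divmod l.
case Et: (trans q (head None r)) => [[[q' a'] m]|].
  have := @exec_record q (head None r) (tape l) (tape r) _ _ _ _ _ hm.
  rewrite /record Et => /(_ _ _ _ _ _ erefl); rewrite hd -tape_cons.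
  have [-> ->] := tape_divmod (a' :: behead r).
  by case: m {Et}; rewrite ?lm ?ld -?tape_cons.
have := @exec_record q (head None r) (tape l) (tape r) _ false false _ _ hm.
rewrite /record Et => /(_ _ _ _ erefl); rewrite hd -tape_cons tape_head_behead.
by [].
Qed.

Notation main_loop := [:: While rM simulate_step; clear_all].
Notation reach := (reaches rX).

Lemma reach_simulate c n c' : iter n (obind (@step _ M)) (Some c) = Some c' ->
  reach (main_loop, config_regs c 1) (main_loop, config_regs c' 1).
Proof.
elim: n c => [|n IH] c; first by case=> ->; exact: reach_refl.
rewrite iterSr /=; case E: (step c) => [c1|]; last by rewrite iter_None.
move/IH; apply: reach_trans.
apply: (@reach_trans _ _ _ (simulate_step :: main_loop, config_regs c 1)).
  by apply: reach_step; exact: pstep_while.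
by have := exec_simulate_step c main_loop; rewrite /next E.
Qed.

Lemma tape_input w : tape (map (fun i => Some (inl i)) w) = prepend base w 0.
Proof. by elim: w => //= i w IH; rewrite tape_cons symbol_code_input IH. Qed.

(** One more round on the halted configuration restores its symbol and state. With flag 1 this
    closes a cycle; with flag 0 the loop ends and the registers are cleared. *)
Lemma simulation u v (c : config M) :
  halts_at (pair_input u v) c ->
  let s := vals 0 (prepend base (pair_input u v) 0) 0 0 1 0 0 in
  if accepting (cstate c) then ~ terminates rX (main_loop, s)
  else reach (main_loop, s) ([::], fun=> 0).
Proof.
case=> -[n run] halt s; rewrite /s {s}.
have -> : vals 0 (prepend base (pair_input u v) 0) 0 0 1 0 0 =
    config_regs (init M (pair_input u v)) 1.
  by rewrite /config_regs [state_code _]state_code_start [tape (cells_right _)]tape_input.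
have loop : pstep rX (main_loop, config_regs c 1) =
    Some (simulate_step :: main_loop, config_regs c 1) by exact: pstep_while.
have := exec_simulate_step c main_loop; rewrite /next halt [_.1]/= [_.2]/=.
case: (accepting _) => back.
  by rewrite (terminates_reach (reach_simulate run)); exact: cycle_not_terminates loop back.
apply: (reach_trans (reach_simulate run)); apply: (reach_trans (reach_step loop)).
apply: (reach_trans back).
apply: (reach_trans (@exec_while0 _ rX rM simulate_step (config_regs c 0) erefl [:: clear_all])).
exact: exec_clear_all.
Qed.

End Simulation.

Theorem theorem4p8 :
  exists (X : finType) (S : seq (seq X * seq X)),
    multihomogeneous S /\
    ~ tm_decidable (fun u v : seq X => oconj (word_class S u) (word_class S v)).
Proof.
exists gen, (rules rX universal); split; first exact: multihomogeneous_rules.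
case=> M decides.
(* The input registers hold the table and base of the supposed decider itself. *)
pose s := input_regs (encode M (table M)) (base M).
have [c halt accept] := decides (start_word universal s) (final_word universal s).
have start : reaches rX ([:: universal], s) ([:: While rM (simulate_step); clear_all],
    regs_val (encode M (table M)) (base M) 0
      (prepend (base M) (pair_input (start_word universal s) (final_word universal s)) 0)
      0 0 1 0 0).
  apply: (reach_trans (reach_seq _ _ _ _ _)).
  apply: (reach_trans (writes_input (encode M (table M)) (base M) 0 _)).
  apply: (reach_trans (reach_seq _ _ _ _ _)).
  apply: (reach_trans (exec_incM _ _ _ _ _ _ _ _ _ _)); exact: reach_seq.
have run := simulation halt; cbv zeta in run.
(* If [M] accepts, o-conjugacy makes [universal] halt although the simulation loops; if [M] rejects,
   [universal] halts and the words are o-conjugate after all. *)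
case: ifP run accept => [_ run [/(_ isT) conj _]|_ run [_ conj]].
- by case: run; rewrite -(terminates_reach start); exact: terminates_of_oconj conj.
- suff : false by []; apply: conj.
  exact: oconj_of_reach (reach_trans start run).
Qed.
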